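(* Let $f(X):=h(\mathcal{A}(X)-b)$ for $X\in\mathbb{R}^{n\times m}$, where $h:\mathbb{R}^p\to\mathbb{R}$ is a differentiable $\rho$-strongly convex function, $\mathcal{A}:\mathbb{R}^{n\times m}\to\mathbb{R}^p$ is a linear operator and $b\in\mathbb{R}^p$ is a given vector. Let $M_{r^*}$ be the projection of $\mathcal{A}^*(b)$ onto the set $\{X\in\mathbb{R}^{n\times m}:\mathrm{rank}(X)\le r^*\}$. Suppose that the $2r^*$-restricted smallest eigenvalue $\alpha$ of $\mathcal{A}$ satisfies $$\frac{\rho\alpha\,\sigma_{r^*}(M_{r^*})}{2\sqrt{2}+1}\ \ge\ \big\|\mathcal{A}^*[\nabla h(\mathcal{A}(M_{r^*})-b)]\big\|_F .$$ Let $\lambda>0$ satisfy $$\lambda\in\Big[f(M_{r^*}),\ \frac{\rho\alpha}{16}\Big(\sigma_{r^*}(M_{r^*})-\frac{1}{\rho\alpha}\big\|\mathcal{A}^*(\nabla h(\mathcal{A}(M_{r^*})-b))\big\|\Big)^2\Big].$$ Then, for all small enough $\mu>0$ (i.e. there is $\overline{\mu}>0$ such that for all $\mu\in(0,\overline{\mu})$), every critical point $(\overline{U},\overline{V})$ of $\Phi_{\lambda,\mu}$ such that $$\Phi_{\lambda,\mu}(\overline{U},\overline{V})\le f(M_{r^*})+\mu\|M_{r^*}\|_*+2\lambda r^*$$ satisfies $\mathrm{rank}(\overline{U}\,\overline{V}^{\mathbb{T}})=r^*$.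
   Context: Here $\Phi_{\lambda,\mu}(U,V)=f(UV^{\mathbb{T}})+\frac{\mu}{2}(\|U\|_F^2+\|V\|_F^2)+\lambda(\|U\|_{2,0}+\|V\|_{2,0})$ for $(U,V)\in\mathbb{R}^{n\times r}\times\mathbb{R}^{m\times r}$, where $\|Z\|_{2,0}$ is the number of nonzero columns of $Z$. Standing assumptions: $n\le m$; $r^*\ge 1$ is an integer (the rank of the unknown true matrix) and $r$ is an integer upper estimate of it, $r^*\le r\le n$; $f$ takes values in $\mathbb{R}_+=[0,\infty)$ and is smooth with Lipschitz continuous gradient. The $2r^*$-restricted smallest eigenvalue $\alpha>0$ of $\mathcal{A}$ is the largest constant with $\|\mathcal{A}(X)\|^2\ge\alpha\|X\|_F^2$ for all $X$ with $\mathrm{rank}(X)\le 2r^*$. $\mathcal{A}^*$ is the adjoint of $\mathcal{A}$; $\sigma_i(X)$ is the $i$th largest singular value; $\|\cdot\|$ (of a matrix), $\|\cdot\|_F$, $\|\cdot\|_*$ are the spectral, Frobenius and nuclear norms. A critical point of a function $\Phi$ is a point $x$ with $0\in\partial\Phi(x)$, where $\partial\Phi(x)=\{v:\exists x^k\to x,\ \Phi(x^k)\to\Phi(x),\ v^k\in\widehat{\partial}\Phi(x^k),\ v^k\to v\}$ is the limiting subdifferential and $\widehat{\partial}\Phi(x)=\{v:\liminf_{x'\to x,\,x'\ne x}\frac{\Phi(x')-\Phi(x)-\langle v,x'-x\rangle}{\|x'-x\|}\ge 0\}$. *)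

(* Defs.v *)
From HB Require Import structures.
From mathcomp Require Import all_boot all_order all_algebra.
From mathcomp Require Import polyrcf.
From mathcomp Require Import all_classical all_reals all_analysis.

Set Implicit Arguments.
Unset Strict Implicit.
Unset Printing Implicit Defensive.

Import Order.TTheory GRing.Theory Num.Theory.
Import numFieldNormedType.Exports.

Local Open Scope classical_set_scope.
Local Open Scope ring_scope.

(* The library norm `|X| on matrices (and on pairs of matrices) is the entrywise
   maximum norm: it is used below only through the topology it induces, which
   is the Euclidean one.  Every norm occurring in a formula is one of those
   defined here. *)

Definition mxip (R : realType) (a b : nat) (X Y : 'M[R]_(a, b)) : R :=
  \tr (X^T *m Y).

Definition frob (R : realType) (a b : nat) (X : 'M[R]_(a, b)) : R :=
  Num.sqrt (mxip X X).

(* Square roots of the eigenvalues of X X^T, with multiplicity, in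
   nonincreasing order (rootsR lists the distinct real roots increasingly).
   There are a of them, so when a > b the list ends with a - b zeros in
   addition to the usual min(a, b) singular values. *)
Definition singular_values (R : realType) (a b : nat) (X : 'M[R]_(a, b)) :
    seq R :=
  let q := char_poly (X *m X^T) in
  rev (flatten [seq nseq (mup x q) (Num.sqrt x) | x <- rootsR q]).

(* The index starts at 1: sigma 1 X is the largest singular value. *)
Definition sigma (R : realType) (a b : nat) (i : nat) (X : 'M[R]_(a, b)) : R :=
  nth 0 (singular_values X) i.-1.

Definition spectral_norm (R : realType) (a b : nat) (X : 'M[R]_(a, b)) : R :=
  sigma 1 X.

Definition nuclear_norm (R : realType) (a b : nat) (X : 'M[R]_(a, b)) : R :=
  \sum_(s <- singular_values X) s.

Definition col20 (R : realType) (a b : nat) (Z : 'M[R]_(a, b)) : nat :=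
  #|[pred j : 'I_b | col j Z != 0]|.

(* Gradient for the inner product mxip; column vectors are the case b = 1. *)
Definition grad (R : realType) (a b : nat) (g : 'M[R]_(a, b) -> R)
    (X : 'M[R]_(a, b)) : 'M[R]_(a, b) :=
  \matrix_(i, j) 'D_(delta_mx i j) g X.

Definition lipschitz_smooth (R : realType) (a b : nat)
    (g : 'M[R]_(a, b) -> R) : Prop :=
  (forall X, differentiable g X) /\
  exists L : R, forall X Y, frob (grad g X - grad g Y) <= L * frob (X - Y).

Definition strongly_convex (R : realType) (p : nat) (rho : R)
    (h : 'cV[R]_p -> R) : Prop :=
  0 < rho /\
  forall (x y : 'cV[R]_p) (t : R), 0 <= t -> t <= 1 ->
    h (t *: x + (1 - t) *: y) <=
      t * h x + (1 - t) * h y - rho / 2 * t * (1 - t) * frob (x - y) ^+ 2.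

Definition adjoint (R : realType) (a b p : nat)
    (A : {linear 'M[R]_(a, b) -> 'cV[R]_p}) (y : 'cV[R]_p) : 'M[R]_(a, b) :=
  \matrix_(i, j) mxip (A (delta_mx i j)) y.

Lemma adjointP (R : realType) (a b p : nat)
    (A : {linear 'M[R]_(a, b) -> 'cV[R]_p}) (X : 'M[R]_(a, b)) (y : 'cV[R]_p) :
  mxip (A X) y = mxip X (adjoint A y).
Proof.
have mxipE c d (P Q : 'M[R]_(c, d)) : mxip P Q = \sum_i \sum_j P i j * Q i j.
  rewrite /mxip /mxtrace exchange_big /=; apply: eq_bigr => i _.
  by rewrite mxE; apply: eq_bigr => j _; rewrite mxE.
rewrite (mxipE _ _ X) {1}[X]matrix_sum_delta /mxip linear_sum (raddf_sum trmx).
rewrite mulmx_suml raddf_sum; apply: eq_bigr => i _ /=.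
rewrite linear_sum (raddf_sum trmx) mulmx_suml raddf_sum /=.
apply: eq_bigr => j _.
by rewrite !linearZ /= -scalemxAl mxtraceZ mxE.
Qed.

(* Set-valued projection: the minimiser is not unique in general. *)
Definition is_rank_projection (R : realType) (a b k : nat)
    (Y M : 'M[R]_(a, b)) : Prop :=
  (\rank M <= k)%N /\
  forall Z : 'M[R]_(a, b), (\rank Z <= k)%N -> frob (Y - M) <= frob (Y - Z).

Definition is_restricted_smallest_eigenvalue (R : realType) (a b p k : nat)
    (A : {linear 'M[R]_(a, b) -> 'cV[R]_p}) (alpha : R) : Prop :=
  let lower c := forall X : 'M[R]_(a, b), (\rank X <= k)%N ->
    c * frob X ^+ 2 <= frob (A X) ^+ 2 in
  lower alpha /\ forall c : R, lower c -> c <= alpha.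

(* Subdifferentials on a normed space E whose Euclidean structure is given by
   the inner product ip; x^' is the filter of punctured neighbourhoods of x. *)
Definition regular_subdiff (R : realType) (E : normedModType R)
    (ip : E -> E -> R) (Phi : E -> R) (x : E) : set E :=
  [set v | (0 <= limf_einf (fun x' : E =>
     ((Phi x' - Phi x - ip v (x' - x)) /
        Num.sqrt (ip (x' - x) (x' - x)))%:E) x^')%E].

Definition limiting_subdiff (R : realType) (E : normedModType R)
    (ip : E -> E -> R) (Phi : E -> R) (x : E) : set E :=
  [set v | exists xs vs : nat -> E,
     [/\ xs @ \oo --> x, (fun k => Phi (xs k)) @ \oo --> Phi x,
         forall k, regular_subdiff ip Phi (xs k) (vs k) &
         vs @ \oo --> v]].

Definition pairip (R : realType) (n m r : nat)
    (W W' : 'M[R]_(n, r) * 'M[R]_(m, r)) : R :=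
  mxip W.1 W'.1 + mxip W.2 W'.2.

Definition Phi (R : realType) (n m r : nat) (f : 'M[R]_(n, m) -> R)
    (lambda mu : R) (W : 'M[R]_(n, r) * 'M[R]_(m, r)) : R :=
  f (W.1 *m W.2^T) + mu / 2 * (frob W.1 ^+ 2 + frob W.2 ^+ 2)
  + lambda * (col20 W.1 + col20 W.2)%:R.

Definition critical_point (R : realType) (n m r : nat)
    (F : 'M[R]_(n, r) * 'M[R]_(m, r) -> R)
    (W : 'M[R]_(n, r) * 'M[R]_(m, r)) : Prop :=
  limiting_subdiff (@pairip R n m r) F W 0.

(* Main.v *)
Require Import Defs.
From HB Require Import structures.
From mathcomp Require Import all_boot all_order all_algebra.
From mathcomp Require Import spectral sesquilinear.
From mathcomp Require Import polyrcf complex.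
From mathcomp Require Import ring lra zify.
From mathcomp Require Import all_classical all_reals all_analysis.
Set Implicit Arguments.
Unset Strict Implicit.
Unset Printing Implicit Defensive.
Import Order.TTheory GRing.Theory Num.Theory.
Import numFieldNormedType.Exports.
Local Open Scope classical_set_scope.
Local Open Scope ring_scope.

(* Put X = U V^T, k = rank X, and take mu so small that mu ||M||_* < lambda.

   Each of U, V has at least k nonzero columns, while f >= 0 and
   f M <= lambda, so the bound forces 2 k < 2 rs + 2, i.e. k <= rs.

   Suppose k < rs and put d = rs - k >= 1, s = sigma rs M, G = grad f M,
   F = ||X - M||_F^2.  The bound gives f X - f M < lambda (1 + 2 d).  Strong
   convexity and the restricted eigenvalue give
   f X - f M >= <G, X - M> + rho alpha F / 2, and the Eckart-Young bound gives
   d s^2 <= F.  As ||G||_F <= (2/7) rho alpha s and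
   lambda <= rho alpha s^2 / 16, these are incompatible.

   The Eckart-Young bound comes from the spectral theorem for M M^T over the
   complex numbers: restrict to the eigenvectors of eigenvalue >= s^2 (at least
   rs of them) and inside that space to the left kernel of X (dimension >= d);
   there X - M acts as - M. *)

(** * The Eckart-Young lower bound over the complex numbers *)

Section ComplexMatrices.
Local Open Scope sesquilinear_scope.
Variable C : numClosedFieldType.

Lemma trmxC_mul m n p (A : 'M[C]_(m, n)) (B : 'M[C]_(n, p)) :
  (A *m B)^t* = B^t* *m A^t*.
Proof. by rewrite trmx_mul map_mxM. Qed.

Lemma mxtrace_mulmx_trmxC m n (Y : 'M[C]_(m, n)) :
  \tr (Y *m Y^t*) = \sum_i \sum_j `|Y i j| ^+ 2.
Proof.
apply: eq_bigr => i _; rewrite mxE; apply: eq_bigr => j _.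
by rewrite !mxE normCK.
Qed.

(** As [T] has orthonormal rows, [Z] is an orthogonal projector, and the gap between the two traces
    is the squared Frobenius norm of [Z *m Y]. *)
Lemma mxtrace_unitary_le d m n (T : 'M[C]_(d, m)) (Y : 'M[C]_(m, n)) :
  T \is unitarymx -> \tr (T *m Y *m (T *m Y)^t*) <= \tr (Y *m Y^t*).
Proof.
move=> /unitarymxP TT1; pose Z := 1%:M - T^t* *m T.
have ZZ : Z^t* *m Z = Z.
  have -> : Z^t* = Z.
    by rewrite /Z !linearB /= trmx1 map_mxB map_mx1 trmxC_mul trmxCK.
  rewrite {2}/Z mulmxBr mulmx1 {2}/Z mulmxBl mul1mx.
  by rewrite mulmxA -[_ *m T *m T^t*]mulmxA TT1 mulmx1 subrr subr0.
have ZY : (Z *m Y)^t* *m (Z *m Y) = Y^t* *m Z *m Y.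
  by rewrite trmxC_mul mulmxA -[_ *m _ *m Z]mulmxA ZZ.
have : 0 <= \tr (Z *m Y *m (Z *m Y)^t*).
  rewrite mxtrace_mulmx_trmxC; apply: sumr_ge0 => i _; apply: sumr_ge0 => j _.
  by rewrite exprn_ge0.
rewrite mxtrace_mulC ZY /Z mulmxBr mulmx1 mulmxBl raddfB /= subr_ge0.
by rewrite [leRHS]mxtrace_mulC (mxtrace_mulC (T *m Y)) trmxC_mul !mulmxA.
Qed.

(** The trace is a combination of the [e 0 j] with weights [|Q i j|^2]; orthonormality of the rows
    makes the weights add up to [d]. *)
Lemma mxtrace_unitary_diag_ge d n (Q : 'M[C]_(d, n)) (e : 'rV[C]_n) (c : C) :
  Q \is unitarymx -> (forall j, c <= e 0 j) ->
  d%:R * c <= \tr (Q *m diag_mx e *m Q^t*).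
Proof.
move=> /unitarymxP QQ1 ce.
have -> : d%:R * c = \sum_i \sum_j `|Q i j| ^+ 2 * c.
  rewrite -(mxtrace1 C d) -QQ1 mxtrace_mulmx_trmxC mulr_suml.
  by apply: eq_bigr => i _; rewrite mulr_suml.
apply: ler_sum => i _; rewrite mxE; apply: ler_sum => j _.
rewrite mul_mx_diag !mxE normCK [leRHS]mulrAC -normCK.
by rewrite ler_wpM2l ?exprn_ge0.
Qed.

Lemma eckart_young_mxtrace_ge m n (X Y : 'M[C]_(m, n)) (c : C) : 0 <= c ->
  (#|[pred i | c <= spectral_diag (Y *m Y^t*) 0 i]| - \rank X)%:R * c <=
  \tr ((X - Y) *m (X - Y)^t*).
Proof.
move=> c0; set S := Y *m Y^t*; set I := [pred i | _].
have SH : S \is normalmx.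
  by apply/normalmxP; rewrite /S trmxC_mul trmxCK.
have PU := spectral_unitarymx S; have /orthomx_spectralP SE := SH.
set P := spectralmx S in PU SE; set e := spectral_diag S in SE I *.
rewrite invmx_unitary // in SE.
pose g (i : 'I_#|I|) := enum_val i.
(* The rows of [W] are the orthonormal eigenvectors of [S] with eigenvalue at least [c]. *)
pose W := rowsub g P.
have gI : injective g by exact: enum_val_inj.
have Wt : W^t* = colsub g (P^t*) by rewrite trmx_mxsub map_mxsub.
have WU : W \is unitarymx.
  apply/unitarymxP; rewrite Wt -mxsub_mul (unitarymxP PU).
  by apply/matrixP => i j; rewrite !mxE (inj_eq gI).
have WSW : W *m S *m W^t* = diag_mx (\row_j e 0 (g j)).
  rewrite Wt mul_rowsub_mx -mxsub_mul SE !mulmxA (unitarymxP PU) mul1mx.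
  rewrite -mulmxA (unitarymxP PU) mulmx1.
  by apply/matrixP => i j; rewrite !mxE (inj_eq gI).
pose K := kermx (W *m X); pose Q := schmidt (row_base K).
have QU : Q \is unitarymx by rewrite schmidt_unitarymx ?rank_leq_col.
have QWX : Q *m W *m X = 0.
  rewrite -mulmxA; apply/sub_kermxP.
  by rewrite eqmx_schmidt_free ?row_base_free // eq_row_base.
have rK : (#|I| - \rank X <= \rank K)%N.
  by rewrite mxrank_ker leq_sub2l // mxrankM_maxr.
apply: le_trans (mxtrace_unitary_le _ (mul_unitarymx QU WU)).
rewrite mulmxBr QWX sub0r linearN /= map_mxN mulmxN mulNmx opprK.
have -> : Q *m W *m Y *m (Q *m W *m Y)^t* = Q *m (W *m S *m W^t*) *m Q^t*.
  by rewrite !trmxC_mul !mulmxA.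
apply: le_trans (_ : (\rank K)%:R * c <= _).
  by rewrite ler_wpM2r // ler_nat.
rewrite WSW; apply: mxtrace_unitary_diag_ge => // j.
by rewrite mxE; exact: (enum_valP j).
Qed.

End ComplexMatrices.

(** * Frobenius inner product, first-order strong convexity, rank and nonzero columns *)

Lemma mxipE (R : realType) (a b : nat) (X Y : 'M[R]_(a, b)) :
  mxip X Y = \sum_i \sum_j X i j * Y i j.
Proof.
rewrite /mxip /mxtrace exchange_big /=; apply: eq_bigr => i _.
by rewrite mxE; apply: eq_bigr => j _; rewrite mxE.
Qed.

Lemma mxipC (R : realType) (n m : nat) (X Y : 'M[R]_(n, m)) :
  mxip X Y = mxip Y X.
Proof.
by rewrite !mxipE; apply: eq_bigr => i _; apply: eq_bigr => j _; rewrite mulrC.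
Qed.

Lemma mxip_ge0 (R : realType) (a b : nat) (X : 'M[R]_(a, b)) : 0 <= mxip X X.
Proof.
rewrite mxipE; apply: sumr_ge0 => i _; apply: sumr_ge0 => j _.
by rewrite -expr2 sqr_ge0.
Qed.

Lemma frob_ge0 (R : realType) (a b : nat) (X : 'M[R]_(a, b)) : 0 <= frob X.
Proof. exact: sqrtr_ge0. Qed.

Lemma sqr_frob (R : realType) (a b : nat) (X : 'M[R]_(a, b)) :
  frob X ^+ 2 = mxip X X.
Proof. by rewrite sqr_sqrtr // mxip_ge0. Qed.

(* AM-GM form of Cauchy-Schwarz. *)
Lemma mxip_ge (R : realType) (a b : nat) (c : R) (X Y : 'M[R]_(a, b)) : 0 < c ->
  - (c / 2 * frob Y ^+ 2 + (2 * c)^-1 * frob X ^+ 2) <= mxip X Y.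
Proof.
move=> c0; rewrite !sqr_frob !mxipE -subr_ge0 opprK.
rewrite !mulr_sumr -!big_split /=; apply: sumr_ge0 => i _.
rewrite !mulr_sumr -!big_split /=; apply: sumr_ge0 => j _.
rewrite (_ : _ + _ = (2 * c)^-1 * (X i j + c * Y i j) ^+ 2); last first.
  by field; rewrite gt_eqF.
by rewrite mulr_ge0 ?sqr_ge0 // invr_ge0 mulr_ge0 // ltW.
Qed.

Lemma derive_grad (R : realType) (a b : nat) (g : 'M[R]_(a, b) -> R)
    (X V : 'M[R]_(a, b)) :
  differentiable g X -> 'D_V g X = mxip (grad g X) V.
Proof.
move=> dg; rewrite deriveE // {1}[V]matrix_sum_delta linear_sum mxipE.
apply: eq_bigr => i _; rewrite linear_sum; apply: eq_bigr => j _.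
by rewrite linearZ /= /grad mxE deriveE // mulrC.
Qed.

(** Divide the convexity inequality on the segment from [x] to [y] by [t] and let [t] tend to 0. The
    limit is taken from the right, as the inequality is available only for [t] in [0, 1]. *)
Lemma strongly_convex_grad (R : realType) (p : nat) (rho : R)
    (h : 'cV[R]_p -> R) (x y : 'cV[R]_p) :
  strongly_convex rho h -> differentiable h x ->
  h x + mxip (grad h x) (y - x) + rho / 2 * frob (y - x) ^+ 2 <= h y.
Proof.
move=> [rho0 hc] dh; rewrite -derive_grad //.
have dv : derivable h x (y - x) by exact: diff_derivable.
have cv : (fun t : R => t^-1 *: (h (t *: (y - x) + x) - h x)) @ 0^'+ -->
    'D_(y - x) h x.
  by apply: cvg_dnbhs_at_right; exact: dv.
pose N := frob (y - x) ^+ 2.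
have cw : (fun t : R => h y - h x - rho / 2 * (1 - t) * N) @ 0^'+ -->
    h y - h x - rho / 2 * (1 - 0) * N.
  apply: cvg_at_right_filter; apply: cvgB; first exact: cvg_cst.
  apply: cvgMl; apply: cvgMr; apply: cvgB; [exact: cvg_cst|exact: cvg_id].
suff : 'D_(y - x) h x <= h y - h x - rho / 2 * (1 - 0) * N.
  by rewrite subr0 mulr1 /N; lra.
apply: ler_cvg_to cv cw _; near=> t.
have t0 : 0 < t by near: t; exact: nbhs_right_gt.
have t1 : t < 1 by near: t; exact: nbhs_right_lt.
have := hc y x t (ltW t0) (ltW t1).
have -> : t *: (y - x) + x = t *: y + (1 - t) *: x.
  by rewrite scalerBr scalerBl scale1r addrAC addrA addrAC.
rewrite -/N => ht; rewrite [leLHS]mulrC ler_pdivrMr //.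
set H := h _ in ht *; nra.
Unshelve. all: by end_near.
Qed.

(** Zero columns add nothing to the column space, so the nonzero ones span it; the proof works with
    the rows of the transpose. *)
Lemma rank_le_col20 (R : realType) (a b : nat) (Z : 'M[R]_(a, b)) :
  (\rank Z <= col20 Z)%N.
Proof.
rewrite -mxrank_tr /col20; set I := [pred j | _].
apply: (@leq_trans (\rank (rowsub (fun j : 'I_#|I| => enum_val j) Z^T))).
  apply/mxrankS/row_subP => j.
  have [jI|] := boolP (j \in I).
    by rewrite -(enum_rankK_in jI jI) -row_rowsub row_sub.
  by rewrite inE negbK -tr_col => /eqP ->; rewrite trmx0 sub0mx.
exact: rank_leq_row.
Qed.

(** * Singular values and the eigenvalues of the Gram matrix, with multiplicity *)

Lemma sorted_flatten_nseq (d : Order.disp_t) (T : porderType d) (k : T -> nat)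
    (s : seq T) :
  sorted <%O s -> sorted <=%O (flatten [seq nseq (k x) x | x <- s]).
Proof.
rewrite lt_sorted_pairwise le_sorted_pairwise.
elim: s => //= x s IH /andP[/allP xs /IH ps].
rewrite pairwise_cat ps andbT; apply/andP; split; last first.
  by elim: (k x) => //= j ->; rewrite andbT; apply/allP => y /nseqP[->].
apply/allrelP => y z /nseqP[-> _] /flatten_mapP[w ws /nseqP[-> _]].
exact/ltW/xs.
Qed.

(** For a split polynomial, both lists contain each [y] exactly [mup y q] times. *)
Lemma perm_flatten_mup (R : rcfType) (s : seq R) (q : {poly R}) :
  q = \prod_(x <- s) ('X - x%:P) ->
  perm_eq (flatten [seq nseq (mup x q) x | x <- rootsR q]) s.
Proof.
move=> qE; have q0 : q != 0 by rewrite qE monic_neq0 // monic_prod_XsubC.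
have mupq y : mup y q = count_mem y s.
  rewrite qE; elim: (s) => [|x t IH]; first by rewrite big_nil mupNroot ?root1.
  rewrite big_cons mupM ?polyXsubC_eq0 ?monic_neq0 ?monic_prod_XsubC // IH /=.
  by rewrite -[X in mup _ X]expr1 mup_XsubCX; case: (x == y).
have rq y : (y \in rootsR q) = (y \in s).
  by rewrite -roots_on_rootsR // inE /= qE root_prod_XsubC.
apply/allP => y _ /=; apply/eqP; rewrite -mupq.
rewrite count_flatten -map_comp sumnE big_map.
under eq_bigr => x _ do rewrite /= count_nseq /= mulnbl.
have [yr|yr] := boolP (y \in rootsR q).
  rewrite (bigD1_seq y) ?uniq_roots //= eqxx big1 ?addn0 //.
  by move=> x /negPf ->.
rewrite big1_seq ?mupNroot //.
  by rewrite qE root_prod_XsubC -rq.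
by move=> x /andP[_ xr]; case: eqP => // xy; rewrite -xy xr in yr.
Qed.

Lemma char_poly_similar (F : fieldType) (n : nat) (P A : 'M[F]_n) :
  P \in unitmx -> char_poly (invmx P *m A *m P) = char_poly A.
Proof.
move=> Pu; rewrite /char_poly.
have -> : char_poly_mx (invmx P *m A *m P) =
    map_mx polyC (invmx P) *m char_poly_mx A *m map_mx polyC P.
  rewrite /char_poly_mx mulmxBr mulmxBl !map_mxM; congr (_ - _).
  by rewrite scalar_mxC -mulmxA -map_mxM mulVmx // map_mx1 mulmx1.
by rewrite !det_mulmx mulrAC -det_mulmx -map_mxM mulVmx // map_mx1 det1 mul1r.
Qed.

(** The Gram matrix of a real matrix is Hermitian over the complex numbers, so its eigenvalues are
    real, and the factorization of its characteristic polynomial descends to [R] because the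
    embedding is injective. *)
Lemma gram_spectral (R : rcfType) (n m : nat) (Y : 'M[R]_(n, m)) :
  let Yc := map_mx (real_complex R) Y in
  exists d : 'I_n -> R,
    char_poly (Y *m Y^T) = \prod_(i < n) ('X - (d i)%:P) /\
    forall i, spectral_diag (Yc *m Yc^t*)%sesqui 0 i = real_complex R (d i).
Proof.
move=> Yc; set S := Yc *m _.
have YE : S = map_mx (real_complex R) (Y *m Y^T).
  rewrite map_mxM; congr (_ *m _).
  by apply/matrixP => i j; rewrite !mxE; exact: conjc_real.
have SH : S \is hermsymmx.
  apply/is_hermitianmxP; rewrite expr0 scale1r trmx_mul map_mxM /=.
  by congr (_ *m _); apply/matrixP => i j; rewrite !mxE conjCK.
have /orthomx_spectralP SE := hermitian_normalmx SH.
exists (fun i => complex.Re (spectral_diag S 0 i)).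
have dE i : spectral_diag S 0 i =
    real_complex R (complex.Re (spectral_diag S 0 i)).
  have /mxOverP/(_ 0 i)/complex_realP[x ->] := hermitian_spectral_diag_real SH.
  by [].
split=> //; apply: (map_poly_inj (real_complex R)).
rewrite map_char_poly -YE {1}SE char_poly_similar ?spectral_unit //.
rewrite char_poly_trig ?diag_mx_is_trig // rmorph_prod.
apply: eq_bigr => i _; rewrite mxE eqxx mulr1n {1}dE.
by rewrite -map_polyXsubC.
Qed.

Lemma singular_values_ge0 (R : realType) (n m : nat) (Y : 'M[R]_(n, m))
    (x : R) :
  x \in singular_values Y -> 0 <= x.
Proof.
by rewrite mem_rev => /flatten_mapP[y _ /nseqP[-> _]]; exact: sqrtr_ge0.
Qed.

Lemma sigma_ge0 (R : realType) (k n m : nat) (Y : 'M[R]_(n, m)) :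
  0 <= sigma k Y.
Proof.
rewrite /sigma; have [lt|ge] := ltnP k.-1 (size (singular_values Y)).
  exact/(@singular_values_ge0 _ _ _ Y)/mem_nth.
by rewrite nth_default.
Qed.

Lemma nuclear_norm_ge0 (R : realType) (n m : nat) (Y : 'M[R]_(n, m)) :
  0 <= nuclear_norm Y.
Proof.
by rewrite /nuclear_norm big_seq; apply: sumr_ge0 => x /singular_values_ge0.
Qed.

(** The list of singular values is nonincreasing, so its first [k] entries are all at least
    [sigma k Y]; each is the square root of some [d i]. *)
Lemma card_eigenvalue_ge_sigma (R : realType) (k n m : nat) (Y : 'M[R]_(n, m))
    (d : 'I_n -> R) :
  char_poly (Y *m Y^T) = \prod_(i < n) ('X - (d i)%:P) ->
  (0 < k)%N -> 0 < sigma k Y ->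
  (k <= #|[pred i | (sigma k Y ^+ 2 <= d i)%R]|)%N.
Proof.
move=> qE k0 s0; set s := sigma k Y; set q := char_poly _ in qE.
pose L := flatten [seq nseq (mup x q) x | x <- rootsR q].
have svE : singular_values Y = rev (map Num.sqrt L).
  rewrite /singular_values -/q map_flatten -map_comp; congr (rev (flatten _)).
  by apply: eq_map => x /=; rewrite map_nseq.
have svS : sorted >=%O (singular_values Y).
  rewrite svE rev_sorted; apply: (homo_sorted (e := <=%O)).
    by move=> x y /= xy; exact: ler_wsqrtr.
  exact/sorted_flatten_nseq/sorted_roots.
have LP : perm_eq L [seq d i | i <- enum 'I_n].
  by apply: perm_flatten_mup; rewrite big_map big_enum.
(* Past the end of the list [nth] would return 0, against [s0]. *)
have ksz : (k.-1 < size (singular_values Y))%N.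
  by rewrite ltnNge; apply/negP => sz; rewrite /sigma nth_default ?ltxx in s0.
have kc : (k <= count (>= s) (singular_values Y))%N.
  have szt : size (take k (singular_values Y)) = k.
    by rewrite size_takel // -(prednK k0).
  rewrite -(cat_take_drop k (singular_values Y)) count_cat.
  apply: leq_trans (leq_addr _ _); rewrite -{1}szt.
  have : all (>= s) (take k (singular_values Y)).
    apply/(all_nthP 0) => i; rewrite szt => ik; rewrite nth_take //.
    apply: (sorted_leq_nth ge_trans ge_refl 0 svS) => //; rewrite ?inE //.
    - by apply: leq_ltn_trans ksz; rewrite -ltnS prednK.
    - by rewrite -ltnS prednK.
  by rewrite all_count => /eqP ->.
apply: (leq_trans kc); rewrite svE count_rev count_map (seq.permP LP) count_map.
rewrite enumT cardE /enum_mem size_filter; apply/eq_leq/eq_count => i /=.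
have [di|di] := leP 0 (d i).
  by rewrite inE -[in RHS](sqr_sqrtr di) ler_pXn2r // nnegrE ?sqrtr_ge0 ?ltW.
(* For a negative [d i] the square root is 0 by convention, and both tests fail since [s] is
   positive. *)
rewrite inE ltr0_sqrtr // leNgt s0; apply/esym/negbTE; rewrite -ltNge.
by rewrite (lt_le_trans di) ?sqr_ge0.
Qed.

(** * The Eckart-Young bound for real matrices *)

Lemma mxtrace_real_complex (R : realType) (n m : nat) (Z : 'M[R]_(n, m)) :
  let Zc := map_mx (real_complex R) Z in
  \tr (Zc *m Zc^t*)%sesqui = real_complex R (frob Z ^+ 2).
Proof.
rewrite /= mxtrace_mulmx_trmxC sqr_frob mxipE rmorph_sum.
apply: eq_bigr => i _; rewrite rmorph_sum; apply: eq_bigr => j _.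
by rewrite mxE normCK rmorphM /=; congr (_ * _); exact: conjc_real.
Qed.

(** The complex bound read back over [R]. The case [sigma k Y = 0], which covers indices past the
    end of the list, is set apart because the eigenvalue count needs a positive value. *)
Lemma eckart_young_frob_ge (R : realType) (k n m : nat) (X Y : 'M[R]_(n, m)) :
  (k - \rank X)%:R * sigma k Y ^+ 2 <= frob (X - Y) ^+ 2.
Proof.
have [->|k0] := posnP k; first by rewrite sub0n mul0r sqr_ge0.
have [s0|] := ltP 0 (sigma k Y); last first.
  move=> s0; have -> : sigma k Y = 0 by apply/le_anti; rewrite s0 sigma_ge0.
  by rewrite expr0n mulr0 sqr_ge0.
have [d [qE dE]] := gram_spectral Y.
have kle := card_eigenvalue_ge_sigma qE k0 s0.
have c0 : 0 <= real_complex R (sigma k Y ^+ 2) by rewrite ler0c sqr_ge0.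
have := eckart_young_mxtrace_ge (map_mx (real_complex R) X)
  (map_mx (real_complex R) Y) c0.
rewrite -map_mxB mxtrace_real_complex mxrank_map.
rewrite (eq_card (B := [pred i | sigma k Y ^+ 2 <= d i])); last first.
  by move=> i; rewrite !inE dE lecR.
rewrite -(rmorph_nat (real_complex R)) -rmorphM /= lecR.
by apply: le_trans; rewrite ler_wpM2r ?sqr_ge0 // ler_nat leq_sub2r.
Qed.

(** This is the Eckart-Young bound for [k = 1] and the zero matrix. *)
Lemma spectral_norm_le_frob (R : realType) (n m : nat) (Y : 'M[R]_(n, m)) :
  spectral_norm Y <= frob Y.
Proof.
have := eckart_young_frob_ge 1 0 Y; rewrite mxrank0 subn0 mul1r sub0r.
have -> : frob (- Y) = frob Y.
  rewrite /frob !mxipE; congr Num.sqrt; apply: eq_bigr => i _.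
  by apply: eq_bigr => j _; rewrite !mxE mulrNN.
by rewrite ler_pXn2r // nnegrE ?frob_ge0 ?sigma_ge0.
Qed.

(** * From the bound on the objective to the rank *)

Theorem proposition2p6 (R : realType) (n m p r rs : nat)
  (hnm : (n <= m)%N) (hrs : (1 <= rs)%N) (hrsr : (rs <= r)%N) (hrn : (r <= n)%N)
  (h : 'cV[R]_p -> R) (A : {linear 'M[R]_(n, m) -> 'cV[R]_p}) (b : 'cV[R]_p)
  (f : 'M[R]_(n, m) -> R) (hf : forall X, f X = h (A X - b))
  (f_ge0 : forall X, 0 <= f X) (f_smooth : lipschitz_smooth f)
  (rho : R) (h_diff : forall y, differentiable h y)
  (h_sc : strongly_convex rho h)
  (M : 'M[R]_(n, m)) (hM : is_rank_projection rs (adjoint A b) M)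
  (alpha : R) (alpha_gt0 : 0 < alpha)
  (halpha : is_restricted_smallest_eigenvalue (2 * rs) A alpha)
  (hsig : frob (adjoint A (grad h (A M - b))) <=
          rho * alpha * sigma rs M / (2 * Num.sqrt 2 + 1))
  (lambda : R) (lambda_gt0 : 0 < lambda)
  (hlambda_lo : f M <= lambda)
  (hlambda_hi : lambda <= rho * alpha / 16 *
     (sigma rs M
      - (rho * alpha)^-1 * spectral_norm (adjoint A (grad h (A M - b)))) ^+ 2) :
  exists mubar : R, 0 < mubar /\
    forall mu : R, 0 < mu -> mu < mubar ->
    forall (U : 'M[R]_(n, r)) (V : 'M[R]_(m, r)),
      critical_point (Phi f lambda mu) (U, V) ->
      Phi f lambda mu (U, V) <=
        f M + mu * nuclear_norm M + 2 * lambda * rs%:R ->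
      \rank (U *m V^T) = rs.
Proof.
set G := adjoint A _ in hsig hlambda_hi; set s := sigma rs M in hsig hlambda_hi.
have rho_gt0 : 0 < rho by case: h_sc.
have nuc_ge0 := nuclear_norm_ge0 M.
have nuc1_gt0 : 0 < nuclear_norm M + 1 by lra.
(* This choice gives [mu * nuclear_norm M < lambda]; the added 1 keeps the denominator positive when
   the norm vanishes. *)
exists (lambda / (nuclear_norm M + 1)); split; first exact: divr_gt0.
move=> mu mu_gt0; rewrite ltr_pdivlMr // => mu_lt U V _.
set X := U *m V^T; rewrite /Phi /= -/X => PhiW.
have mu_nuc : mu * nuclear_norm M < lambda.
  by apply: le_lt_trans mu_lt; rewrite ler_wpM2l ?ltW //; lra.
have reg_ge0 : 0 <= mu / 2 * (frob U ^+ 2 + frob V ^+ 2).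
  by rewrite mulr_ge0 ?addr_ge0 ?sqr_ge0 // divr_ge0 // ltW.
have rU : (\rank X <= col20 U)%N.
  exact: leq_trans (mxrankM_maxl _ _) (rank_le_col20 U).
have rV : (\rank X <= col20 V)%N.
  by apply: leq_trans (mxrankM_maxr _ _) _; rewrite mxrank_tr rank_le_col20.
have rX : (\rank X <= rs)%N.
  have fX := f_ge0 X.
  have : (col20 U + col20 V)%:R < (2 * rs + 2)%:R :> R.
    by rewrite -(ltr_pM2l lambda_gt0) [(2 * rs + 2)%:R]natrD natrM; lra.
  rewrite ltr_nat; clear -rU rV; lia.
apply/eqP; rewrite eqn_leq rX /= leqNgt; apply/negP => rlt.
have [rM _] := hM; have [Alow _] := halpha.
set F := frob (X - M) ^+ 2; set c0 := rho * alpha in hsig hlambda_hi.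
set g2 := frob G ^+ 2.
have c0_gt0 : 0 < c0 by exact: mulr_gt0.
have s_ge0 : 0 <= s by exact: sigma_ge0.
have c0_ge0 := ltW c0_gt0.
have c0s_ge0 : 0 <= c0 * s by exact: mulr_ge0.
(* The constant 7/2 is a rational lower bound of [2 * Num.sqrt 2 + 1], from 5/4 <= sqrt 2. *)
have g_le : frob G <= c0 * s / (7 / 2).
  apply: (le_trans hsig); rewrite ler_wpM2l //.
  rewrite lef_pV2 ?posrE; [|have := sqrtr_ge0 (2 : R); lra|lra].
  have : 5 / 4 <= Num.sqrt 2 :> R.
    have -> : 5 / 4 = Num.sqrt ((5 / 4) ^+ 2) :> R.
      by rewrite sqrtr_sqr ger0_norm //; lra.
    by rewrite ler_wsqrtr //; lra.
  lra.
have g2_le : g2 <= c0 ^+ 2 * s ^+ 2 / (49 / 4).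
  have -> : c0 ^+ 2 * s ^+ 2 / (49 / 4) = (c0 * s / (7 / 2)) ^+ 2 by field.
  by rewrite ler_sqr ?nnegrE ?frob_ge0 // (le_trans (frob_ge0 G) g_le).
(* The subtracted spectral term lies between 0 and [s / (7 / 2)], so the squared difference is at
   most [s ^+ 2]. *)
have lam_le : lambda <= c0 / 16 * s ^+ 2.
  apply: (le_trans hlambda_hi); rewrite ler_wpM2l ?divr_ge0 //.
  have sp0 : 0 <= c0^-1 * spectral_norm G.
    by rewrite mulr_ge0 ?invr_ge0 // sigma_ge0.
  have sp1 : c0^-1 * spectral_norm G <= s / (7 / 2).
    rewrite ler_pdivrMl // (le_trans (spectral_norm_le_frob G)) //.
    by rewrite mulrA.
  by move: sp0 sp1; move: (c0^-1 * _) => x; nra.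
have FX : (rs - \rank X)%:R * s ^+ 2 <= F by exact: eckart_young_frob_ge.
have fX : f M + mxip G (X - M) + c0 / 2 * F <= f X.
  rewrite !hf; have := @strongly_convex_grad _ _ _ _ (A M - b) (A X - b) h_sc
    (h_diff _).
  have -> : A X - b - (A M - b) = A (X - M).
    by rewrite [A (X - M)]linearB opprB addrA subrK.
  (* Both [X] and [M] have rank at most [rs], so [X - M] falls within the restricted eigenvalue
     bound. *)
  have : alpha * F <= frob (A (X - M)) ^+ 2.
    apply: Alow; apply: leq_trans (mxrank_add _ _) _.
    by rewrite mxrank_opp mul2n -addnn leq_add.
  have -> : mxip (grad h (A M - b)) (A (X - M)) = mxip G (X - M).
    by rewrite mxipC adjointP mxipC.
  rewrite -(ler_pM2l (divr_gt0 rho_gt0 (ltr0Sn _ 1))).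
  by rewrite (_ : rho / 2 * (alpha * F) = c0 / 2 * F); [lra|rewrite /c0; ring].
(* The weight c0 / 4 is one for which 1/2 - 1/8 - 8/49 > 3/16. *)
have : - (c0 / 4 / 2 * F + (2 * (c0 / 4))^-1 * g2) <= mxip G (X - M).
  by apply: mxip_ge; rewrite divr_gt0.
have : (2 * (c0 / 4))^-1 * g2 <= 8 / 49 * (c0 * s ^+ 2).
  rewrite ler_pdivrMl; last by rewrite mulr_gt0 ?divr_gt0.
  apply: (le_trans g2_le); rewrite le_eqVlt; apply/orP; left.
  by apply/eqP; field.
have D1 : 1 <= (rs - \rank X)%:R :> R by rewrite (ler_nat _ 1) subn_gt0.
have rsE : rs%:R = (\rank X)%:R + (rs - \rank X)%:R :> R.
  by rewrite -natrD subnKC // ltnW.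
have cols : lambda * (2 * (\rank X)%:R) <= lambda * (col20 U + col20 V)%:R.
  by rewrite ler_wpM2l ?(ltW lambda_gt0) // -natrM ler_nat mul2n -addnn leq_add.
have sF : s ^+ 2 <= F by apply: le_trans FX; rewrite ler_peMl ?sqr_ge0.
(* As [d = rs - \rank X] is at least 1, [1 + 2 d <= 3 d]; then [lam_le] and [FX] apply. *)
have lamD : lambda * (1 + 2 * (rs - \rank X)%:R) <= 3 / 16 * (c0 * F).
  apply: (@le_trans _ _ (3 / 16 * (c0 * ((rs - \rank X)%:R * s ^+ 2)))).
    move: lam_le D1; move: (rs - _)%:R (s ^+ 2) => D t; nra.
  by rewrite !ler_wpM2l.
have cF : c0 * s ^+ 2 <= c0 * F by rewrite ler_wpM2l.
have cF0 : 0 <= c0 * F by rewrite mulr_ge0 ?sqr_ge0.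
rewrite rsE in PhiW.
move: PhiW fX cols lamD cF cF0.
(* With the products turned into atoms the contradiction is linear; its strictness comes from
   [mu_nuc]. *)
move: (c0 * s ^+ 2) => cs; move: ((2 * (c0 / 4))^-1 * g2) => gg.
rewrite (_ : c0 / 4 / 2 * F = c0 * F / 8) 1?(_ : c0 / 2 * F = c0 * F / 2);
  [|by field|by field].
move: (c0 * F) => cF; lra.
Qed.
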